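(* Suppose that (i) $K:\mathbb{R}^2\to\mathbb{R}$ is a symmetric, homogeneous and twice differentiable mean; (ii) $M:(0,\infty)\times(0,\infty)\to(0,\infty)$ and $N:\mathbb{R}^2\to\mathbb{R}$ are two symmetric, homogeneous and differentiable means; (iii) $r:(0,\infty)\to(-\infty,\infty)$ satisfies $\lim_{x\to\infty}r(x)=0$. Then for fixed real numbers $\epsilon,\epsilon^{\ast},\theta,\theta^{\ast},\sigma,\sigma^{\ast}$ with $\epsilon+\epsilon^{\ast}=\theta+\theta^{\ast}=\sigma+\sigma^{\ast}=1$ (and $x>-\min(1,\theta,\theta^{\ast})$), we have $$\Gamma(x+1)\sim\sqrt{2\pi}\,M(x+\theta,x+\theta^{\ast})^{K(x+\epsilon,x+\epsilon^{\ast})}\,e^{-N(x+\sigma,x+\sigma^{\ast})}\,e^{r(x)}\quad\text{as }x\to\infty.$$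
   Context: $\Gamma$ is Euler's gamma function. For an interval $I\subseteq\mathbb{R}$, a function $M:I^2\to\mathbb{R}$ is a (bivariate) mean if $\min(a,b)\le M(a,b)\le\max(a,b)$ for all $a,b\in I$. It is symmetric if $M(a,b)=M(b,a)$ for all $a,b\in I$, and homogeneous (of degree one) if $M(ta,tb)=tM(a,b)$ for all $a,b\in I$ and $t>0$. (Twice) differentiable means (twice) differentiable as a function of two variables. The notation $f(x)\sim g(x)$ as $x\to\infty$ means $\lim_{x\to\infty}f(x)/g(x)=1$. *)

(* Defs.v *)
From HB Require Import structures.
From mathcomp Require Import all_boot all_order all_algebra.
From mathcomp Require Import all_classical all_reals all_analysis.

Set Implicit Arguments.
Unset Strict Implicit.
Unset Printing Implicit Defensive.

Import Order.TTheory GRing.Theory Num.Theory.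
Import numFieldNormedType.Exports.

Local Open Scope classical_set_scope.
Local Open Scope ring_scope.

(* Euler's integral; meaningful for s > 0, where it converges. *)
Definition Gamma (R : realType) (s : R) : R :=
  \int[lebesgue_measure]_(t in `]0, +oo[) (t `^ (s - 1) * expR (- t)).

(* A function I^2 -> R is represented by a total function R * R -> R: the
   predicates below constrain only its values at pairs of elements of I. *)

Definition is_mean (R : realType) (I : set R) (M : R * R -> R) : Prop :=
  forall a b, I a -> I b ->
    Num.min a b <= M (a, b) /\ M (a, b) <= Num.max a b.

Definition symmetric_on (R : realType) (I : set R) (M : R * R -> R) : Prop :=
  forall a b, I a -> I b -> M (a, b) = M (b, a).

(* For the sets I = R and I = (0, +oo) used here, I is stable under
   multiplication by t > 0. *)
Definition homogeneous_on (R : realType) (I : set R) (M : R * R -> R) : Prop :=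
  forall a b t, I a -> I b -> 0 < t -> M (t * a, t * b) = t * M (a, b).

(* Frechet differentiability, as a function of two variables, at every point of
   I^2; I is meant to be open, so that values of f outside I^2 are irrelevant. *)
Definition differentiable_on (R : realType) (I : set R) (V : normedModType R)
    (f : R * R -> V) : Prop :=
  forall p, (I `*` I) p -> differentiable f p.

Definition gradient (R : realType) (f : R * R -> R) (p : R * R) : R * R :=
  ('D_(1, 0) f p, 'D_(0, 1) f p).

(* The derivative of f at p is the linear form with coordinates gradient f p, so
   differentiability of the derivative is that of the gradient. *)
Definition twice_differentiable_on (R : realType) (I : set R)
    (f : R * R -> R) : Prop :=
  differentiable_on I f /\ differentiable_on I (gradient f).

(* f(x) ~ g(x) as x tends to +oo with x restricted to D. *)
Definition asymp_equiv_on (R : realType) (D : set R) (f g : R -> R) : Prop :=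
  f x / g x @[x --> within D +oo] --> (1 : R).

(* Main.v *)
(* A homogeneous function that is differentiable at the origin coincides with its
   derivative there, so K and N are linear, hence both are the arithmetic mean.
   M need not be: it is only differentiable at (1, 1), where symmetry forces its
   derivative to be (u, v) |-> (u + v) / 2; by homogeneity
   x ln (M (x + theta, x + theta') / x) tends to 1/2.  The claim then reduces to
   Stirling's formula for the real Gamma function, obtained by Laplace's method:
   t = x + s sqrt x turns Gamma (x + 1) into sqrt x (x / e) ^ x times an integral
   over s converging to the Gaussian one by dominated convergence. *)
Require Import Defs.
From HB Require Import structures.
From mathcomp Require Import all_boot all_order all_algebra.
From mathcomp Require Import all_classical all_reals all_analysis.
From mathcomp Require Import measurable_realfun ring lra.

Set Implicit Arguments.
Unset Strict Implicit.
Unset Printing Implicit Defensive.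

Import Order.TTheory GRing.Theory Num.Theory.
Import numFieldNormedType.Exports.

Local Open Scope classical_set_scope.
Local Open Scope ring_scope.

(** * Symmetric homogeneous means and their first-order behaviour *)

Lemma mean_diag (R : realType) (I : set R) (M : R * R -> R) (t : R) :
  is_mean I M -> I t -> M (t, t) = t.
Proof.
move=> M_mean It; have [] := M_mean t t It It; rewrite minxx maxxx => h1 h2.
exact/le_anti/andP.
Qed.

Lemma symmetric_linear_form_half (R : realType) (L : R * R -> R)
  (L_lin : forall (k : R) (u v : R * R), L (k *: u + v) = k * L u + L v)
  (L_sym : L (1, 0) = L (0, 1)) (L11 : L (1, 1) = 1) (a b : R) :
  L (a, b) = (a + b) / 2.
Proof.
have L0 : L (0, 0) = 0.
  have := L_lin 1 (0, 0) (0, 0); rewrite mul1r scale1r.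
  rewrite (_ : (0, 0) + (0, 0) = (0, 0) :> R * R); first by move/eqP; lra.
  by congr (_, _); rewrite /= addr0.
have Lab p q : L (p, q) = p * L (1, 0) + q * L (0, 1).
  have -> : (p, q) = p *: (1, 0) + (q *: (0, 1) + (0, 0)) :> R * R.
    by congr (_, _) => /=; rewrite /GRing.scale /=; ring.
  by rewrite !L_lin L0 addr0.
rewrite Lab -L_sym; move: L11; rewrite Lab -L_sym => /eqP; nra.
Qed.

(** Slopes are taken from the right because homogeneity only allows positive factors. *)
Lemma diff_right_slope (R : realType) (f : R * R -> R) (a v : R * R) :
  differentiable f a ->
  h^-1 * (f (h * v.1 + a.1, h * v.2 + a.2) - f a) @[h --> 0^'+] --> 'd f a v.
Proof.
move=> df; have := @diff_derivable _ _ _ _ _ v df.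
by rewrite -deriveE// => /cvg_dnbhs_at_right.
Qed.

Lemma homogeneous_mean_arith (R : realType) (K : R * R -> R)
  (K_mean : is_mean setT K) (K_sym : symmetric_on setT K)
  (K_hom : homogeneous_on setT K) (K_diff : differentiable K (0, 0)) (a b : R) :
  K (a, b) = (a + b) / 2.
Proof.
have Kdiag t : K (t, t) = t by exact: mean_diag K_mean _.
(* by homogeneity the difference quotients of K at 0 along v are constant *)
have KE v : K v = 'd K (0, 0) v.
  have /cvg_lim <- // := diff_right_slope (v := v) K_diff.
  apply/esym/lim_near_cst => //; near=> h.
  have h0 : 0 < h by near: h; exact: nbhs_right_gt.
  rewrite /= Kdiag subr0 !addr0.
  by rewrite K_hom// -surjective_pairing mulKf// gt_eqF.
apply: symmetric_linear_form_half => [k u v||]; last exact: Kdiag.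
  by rewrite !KE linearD linearZ.
exact: K_sym.
Unshelve. all: by end_near. Qed.

Lemma symmetric_mean_diff_half (R : realType) (M : R * R -> R)
  (M_mean : is_mean `]0, +oo[ M) (M_sym : symmetric_on `]0, +oo[ M)
  (M_diff : differentiable M (1 : R, 1 : R)) (a b : R) :
  'd M (1 : R, 1 : R) (a, b) = (a + b) / 2.
Proof.
have Mdiag t : 0 < t -> M (t, t) = t.
  by move=> t0; apply: mean_diag M_mean _; rewrite /= in_itv/= t0.
apply: symmetric_linear_form_half => [k p q||].
- by rewrite linearD linearZ.
- have /cvg_lim <- // := diff_right_slope (v := (1, 0)) M_diff.
  have /cvg_lim <- // := diff_right_slope (v := (0, 1)) M_diff.
  (* Swapping the arguments turns the slope along [(1, 0)] into the slope along [(0, 1)]; [0 < h]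
     keeps the points where [M_sym] applies. *)
  congr (lim _); rewrite eqEsubset; split; apply: near_eq_cvg; near=> h => /=;
    rewrite !mulr1 !mulr0 !add0r; (rewrite M_sym//= in_itv/= andbT ?ltr01//);
    by rewrite addr_gt0//; near: h; exact: nbhs_right_gt.
- have /cvg_lim <- // := diff_right_slope (v := (1, 1)) M_diff.
  apply: lim_near_cst => //; near=> h.
  have h0 : 0 < h by near: h; exact: nbhs_right_gt.
  by rewrite /= mulr1 !Mdiag ?addr_gt0// addrK mulVf// gt_eqF.
Unshelve. all: by end_near. Qed.

(** With [h = 1 / x], homogeneity turns [M (x + a, x + b) / x] into [M (1 + a h, 1 + b h)], so the
    expression is a difference quotient at 0 of [ln \o f] with [f 0 = 1]. Its limit is the
    derivative of [M] at [(1, 1)] along [(a, b)]. *)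
Lemma mean_ln_asymp (R : realType) (M : R * R -> R)
  (M_mean : is_mean `]0, +oo[ M) (M_sym : symmetric_on `]0, +oo[ M)
  (M_hom : homogeneous_on `]0, +oo[ M) (M_diff : differentiable M (1 : R, 1 : R))
  (a b : R) :
  x * ln (M (x + a, x + b) / x) @[x --> +oo] --> (a + b) / 2.
Proof.
have M11 : M (1, 1) = 1 by apply: mean_diag M_mean _; rewrite /= in_itv/= ltr01.
pose f h := M (h *: (a, b) + (1, 1)).
have f0 : f 0 = 1 by rewrite /f scale0r add0r.
have df : is_derive (0 : R) (1 : R) f ((a + b) / 2).
  rewrite -(symmetric_mean_diff_half M_mean M_sym M_diff) -deriveE//.
  apply: DeriveDef.
    have /derivable1P := @diff_derivable _ _ _ _ _ (a, b) M_diff; exact.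
  rewrite /f /derive /=; congr (lim _).
  by apply/seteqP; split; apply: near_eq_cvg; near=> h;
    rewrite addr0 scale0r add0r [_%:A]mulr1.
have dln : is_derive (0 : R) (1 : R) (@ln R \o f) ((a + b) / 2).
  rewrite -[X in is_derive _ _ _ X]mul1r.
  apply: is_derive1_comp; rewrite f0.
  by rewrite -[X in is_derive _ _ _ X]invr1; exact: is_derive1_ln.
have /cvg_dnbhs_at_right := @ex_derive _ _ _ _ _ _ _ dln.
rewrite -[lim _]/('D_1 (@ln R \o f) 0) derive_val => cvg_ln.
have xV : x^-1 @[x --> +oo] --> (0 : R)^'+.
  have V0 : x^-1 @[x --> +oo] --> (0 : R).
    by apply/gtr0_cvgV0 => //; exact: nbhs_pinfty_gt.
  move=> A /V0 /= VA.
  have {}VA : \forall x \near +oo, 0 < (x : R)^-1 -> A x^-1 by exact: VA.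
  change (\forall x \near +oo, A (x : R)^-1); near=> x; apply: (near VA x) => //.
  by rewrite invr_gt0; near: x; exact: nbhs_pinfty_gt.
have := cvg_comp _ _ xV cvg_ln.
apply: cvg_trans; apply: near_eq_cvg; near=> x.
have x0 : 0 < x by near: x; exact: nbhs_pinfty_gt.
have /= xa : 0 < x + a.
  by rewrite -ltrBlDr sub0r; near: x; apply: nbhs_pinfty_gt; rewrite num_real.
have /= xb : 0 < x + b.
  by rewrite -ltrBlDr sub0r; near: x; apply: nbhs_pinfty_gt; rewrite num_real.
rewrite /= f0 ln1 subr0 addr0 [_%:A]mulr1 invrK /GRing.scale/=.
congr (_ * ln _); rewrite /f mulrC -M_hom /= ?in_itv/= ?xa ?xb ?invr_gt0//.
by congr M; congr (_, _); rewrite /= mulrDr mulVf ?gt_eqF// addrC.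
Unshelve. all: by end_near. Qed.

(** * Laplace's method: pointwise limit and uniform bound *)

(** At the junction [t = 0] both sides tend to 0 because [0 < p]. Continuity on the whole line
    serves the change of variables in the Gamma integral. *)
Lemma continuous_max0_powR (R : realType) (p : R) : 0 < p ->
  continuous (fun t : R => Num.max t 0 `^ p).
Proof.
move=> p0 t; have [t0|t0|->] := ltrgtP t 0.
- apply: (@cvg_trans _ ((fun=> 0 : R) @ nbhs t)).
    apply: near_eq_cvg; near=> x; rewrite max_r ?powR0 ?gt_eqF//.
    by near: x; exact: lt_le_nbhsl.
  by rewrite max_r ?powR0 ?gt_eqF// ?(ltW t0)//; exact: cvg_cst.
- apply: (@cvg_trans _ ((fun x : R => x `^ p) @ nbhs t)).
    apply: near_eq_cvg; near=> x; rewrite max_l//.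
    by near: x; exact: lt_le_nbhsr.
  rewrite max_l ?(ltW t0)//.
  have d : derivable (fun x : R => x `^ p) t 1.
    by apply: derivable_powR; rewrite in_itv/= t0.
  by move/derivable1_diffP/differentiable_continuous: d; exact.
- rewrite /continuous_at maxxx powR0 ?gt_eqF//.
  apply/cvgrPdist_lt => e e0.
  have /cvgrPdist_lt /(_ e e0) pe := powR_cvg0 p0.
  have {}pe : \forall x \near (0 : R), 0 < x -> `|0 - x `^ p| < e by exact: pe.
  near=> x; have [x0|x0] := leP x 0; first by rewrite powR0 ?gt_eqF// subrr normr0.
  by apply: (near pe x).
Unshelve. all: by end_near. Qed.

(** Mean value theorem for the remainder [k]: it vanishes at 0, and its derivative [c ^ 2 / (1 + c)]
    is at most [2 u ^ 2] when [|c| <= |u|], since then [1 + c >= 1 / 2]. *)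
Lemma ln1D_taylor2 (R : realType) (u : R) : `|u| <= 2^-1 ->
  `|ln (1 + u) - u + u ^+ 2 / 2| <= 2 * `|u| ^+ 3.
Proof.
move=> u2.
pose k (v : R) := ln (1 + v) - v + v ^+ 2 / 2.
have k0 : k 0 = 0 by rewrite /k addr0 ln1; lra.
have dk (c : R) : - 1 < c -> is_derive c 1 k (c ^+ 2 / (1 + c)).
  move=> c1; have c0 : 0 < 1 + c by lra.
  have dln : is_derive c 1 (fun v : R => ln (1 + v)) ((1 + c)^-1 * (0 + 1)).
    apply: (@is_derive1_comp _ (@ln R) (cst 1 + id)) => //=.
    exact: is_derive1_ln.
  have -> : k = (fun v : R => ln (1 + v)) - id + 2^-1 *: (@id R ^+ 2).
    by apply/funext => v; rewrite /k /GRing.scale /= mulrC.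
  have dp := is_deriveZ 2^-1 (is_deriveX 2 (is_derive_id (c : R) (1 : R))).
  have dq := is_deriveB dln (is_derive_id (c : R) (1 : R)).
  apply: is_derive_eq (is_deriveD dq dp) _; rewrite /GRing.scale /=.
  by field; rewrite gt_eqF.
have kc (a b : R) : - 1 < a -> {within `[a, b], continuous k}.
  move=> a1; apply: derivable_within_continuous => x; rewrite in_itv/= => /andP[ax _].
  by apply: ex_derive; apply: dk; exact: lt_le_trans ax.
have kd c : `|c| <= `|u| -> `|c ^+ 2 / (1 + c)| <= 2 * `|u| ^+ 2.
  move=> cu; have c2 := le_trans cu u2; move: (c2); rewrite ler_norml => /andP[c2l _].
  have c0 : 0 < 1 + c by lra.
  rewrite normrM normfV (gtr0_norm c0) normrX ler_pdivrMr//.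
  have : `|c| ^+ 2 <= `|u| ^+ 2 by rewrite lerXn2r ?nnegrE.
  have := exprn_ge0 2 (normr_ge0 u); nra.
rewrite -/(k u) exprS mulrCA mulrC.
have [u0|/ltW u0] := leP 0 u.
  have [||c] := @MVT_segment R k (fun c => c ^+ 2 / (1 + c)) 0 u u0.
  - by move=> x; rewrite in_itv/= => /andP[x0 _]; apply: dk; lra.
  - by apply: kc; lra.
  rewrite in_itv/= k0 !subr0 => /andP[c0 cu] ->.
  by rewrite normrM ler_wpM2r// kd// !ger0_norm// (le_trans c0).
have [||c] := @MVT_segment R k (fun c => c ^+ 2 / (1 + c)) u 0 u0.
- move=> x; rewrite in_itv/= => /andP[x0 _]; apply: dk.
  by move: u2; rewrite ler_norml => /andP[]; lra.
- by apply: kc; move: u2; rewrite ler_norml => /andP[]; lra.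
rewrite in_itv/= k0 !sub0r => /andP[uc c0] /eqP; rewrite mulrN eqr_opp => /eqP ->.
by rewrite normrM ler_wpM2r// kd// !ler0_norm// lerN2.
Qed.

(* With t = y ^ 2 + y s, the integrand t ^ (y ^ 2) e ^ (- t) of Gamma (y ^ 2 + 1)
   divided by its maximum, attained at t = y ^ 2; the truncation by 0 accounts
   for powR being 1 at negative bases. *)
Definition stirling_kernel (R : realType) (y s : R) :=
  Num.max (1 + s / y) 0 `^ (y ^+ 2) * expR (- (y * s)).

Lemma stirling_kernel_ge0 (R : realType) (y s : R) : 0 <= stirling_kernel y s.
Proof. by rewrite mulr_ge0 ?powR_ge0 ?expR_ge0. Qed.

(** The bound is free of [y], hence usable as the dominating function when [y] tends to infinity. *)
Lemma stirling_kernel_bound (R : realType) (y s : R) : 1 <= y ->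
  stirling_kernel y s <= expR (1 - `|s| / 2).
Proof.
move=> y1; have y0 : 0 < y by lra.
rewrite /stirling_kernel; have [z0|z0] := leP (1 + s / y) 0.
  by rewrite powR0 ?mul0r ?expR_ge0// gt_eqF ?exprn_gt0.
rewrite /powR gt_eqF// -expRD ler_expR.
set z := 1 + s / y in z0 *; pose w := Num.sqrt z.
have w0 : 0 < w by rewrite sqrtr_gt0.
have zw : z = w ^+ 2 by rewrite sqr_sqrtr// ltW.
have -> : s = y * (w ^+ 2 - 1) by rewrite -zw /z; field; rewrite gt_eqF.
(* ln z = 2 ln (sqrt z) <= 2 (sqrt z - 1), so the exponent is at most
   - y ^ 2 (w - 1) ^ 2 *)
have lnz : ln z <= 2 * (w - 1).
  rewrite zw lnXn// -[ln w *+ 2]mulr_natl ler_pM2l//.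
  by have := @le_ln1Dx R (w - 1); rewrite addrCA subrr addr0; apply; lra.
have ylnz : y ^+ 2 * ln z <= y ^+ 2 * (2 * (w - 1)).
  by rewrite ler_pM2l// exprn_gt0.
suff : y * `|w ^+ 2 - 1| / 2 <= y ^+ 2 * (w - 1) ^+ 2 + 1.
  rewrite normrM (gtr0_norm y0); nra.
have -> : w ^+ 2 - 1 = (w - 1) * (w + 1) by ring.
rewrite normrM (@gtr0_norm _ (w + 1)) ?addr_gt0// -(@real_normK _ (w - 1)) ?num_real//.
have dw : w + 1 <= `|w - 1| + 2 by have := ler_norm (w - 1); lra.
have := normr_ge0 (w - 1); move: dw; set d := `|w - 1| => dw d0.
have h1 : d * (w + 1) <= d * (d + 2) by rewrite ler_wpM2l.
have h2 : y * (d * (w + 1)) <= y * (d * (d + 2)) by rewrite ler_pM2l.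
have h3 : y * d ^+ 2 <= y ^+ 2 * d ^+ 2.
  by rewrite ler_wpM2r ?exprn_ge0// expr2 ler_peMl// ltW.
(* It remains to bound [y d (d + 2) / 2 = y d ^ 2 / 2 + y d]: [h3] handles the quadratic term and
   this square the linear one. *)
have := sqr_ge0 (y * d - 1); nra.
Qed.

(** Expand [ln (1 + u)] at [u = s / y]: the linear term cancels [y s], the quadratic one gives
    [- s ^ 2 / 2], and the error is at most [2 |s| ^ 3 / y]. *)
Lemma stirling_kernel_cvg (R : realType) (s : R) :
  stirling_kernel y s @[y --> +oo] --> expR (- (s ^+ 2 / 2)).
Proof.
have expo : y ^+ 2 * ln (1 + s / y) - y * s @[y --> +oo] --> - (s ^+ 2 / 2).
  apply/cvgrPdist_le => e e0; near=> y.
  have y0 : 0 < y by near: y; exact: nbhs_pinfty_gt.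
  (* [ys] puts [s / y] in the range of the Taylor bound; [ye] makes the error at most [e]. *)
  have ys : 2 * `|s| <= y by near: y; apply: nbhs_pinfty_ge; rewrite num_real.
  have ye : 2 * `|s| ^+ 3 / e <= y.
    by near: y; apply: nbhs_pinfty_ge; rewrite num_real.
  have -> : - (s ^+ 2 / 2) - (y ^+ 2 * ln (1 + s / y) - y * s) =
      - (y ^+ 2 * (ln (1 + s / y) - s / y + (s / y) ^+ 2 / 2)).
    by field; rewrite gt_eqF.
  rewrite normrN normrM ger0_norm ?exprn_ge0 ?(ltW y0)//.
  have sy : `|s / y| <= 2^-1.
    by rewrite normrM normfV (gtr0_norm y0) ler_pdivrMr//; lra.
  apply: (@le_trans _ _ (y ^+ 2 * (2 * `|s / y| ^+ 3))).
    by rewrite ler_wpM2l ?exprn_ge0 ?(ltW y0)// ln1D_taylor2.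
  rewrite normrM normfV (gtr0_norm y0).
  have -> : y ^+ 2 * (2 * (`|s| / y) ^+ 3) = 2 * `|s| ^+ 3 / y.
    by field; rewrite gt_eqF.
  by rewrite ler_pdivrMr// [e * _]mulrC -ler_pdivrMr.
have := cvg_comp _ _ expo (@continuous_expR R _).
apply: cvg_trans; apply: near_eq_cvg; near=> y.
have y0 : 0 < y by near: y; exact: nbhs_pinfty_gt.
have ys : - s < y by near: y; apply: nbhs_pinfty_gt; rewrite num_real.
have z0 : 0 < 1 + s / y.
  by rewrite -(@pmulr_lgt0 _ y)// mulrDl divfK ?gt_eqF// mul1r; lra.
by rewrite /= /stirling_kernel max_l ?(ltW z0)// /powR gt_eqF// -expRD.
Unshelve. all: by end_near. Qed.

(** * The dominating function, the Gaussian limit and integrability *)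

Lemma integrable_expR_abs (R : realType) :
  lebesgue_measure.-integrable setT
    (EFin \o (fun s : R => expR (1 - `|s| / 2))).
Proof.
have cf : continuous (fun s : R => expR (1 - `|s| / 2)).
  move=> s; apply: continuous_comp; last exact: continuous_expR.
  apply: cvgB; first exact: cvg_cst.
  by apply: cvgM; [exact: norm_continuous|exact: cvg_cst].
apply/integrableP; split.
  by apply/measurable_EFinP; apply: continuous_measurable_fun; exact: cf.
under eq_integral do rewrite /= ger0_norm ?expR_ge0//.
rewrite ge0_symfun_integralT; last 3 first.
- by move=> s; rewrite expR_ge0.
- exact: cf.
- by move=> s /=; rewrite normrN.
(* By evenness only the half-line [s >= 0] is left, where [F] is a primitive vanishing at
   infinity. *)
pose F (s : R) := - 2 * expR (1 - s / 2).
have dF (x : R) : is_derive x (1 : R) F (expR (1 - x / 2)).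
  have h : is_derive x (1 : R) (cst 1 - (2^-1 *: id)) (0 - 2^-1 *: (1 : R)).
    by apply: is_deriveB.
  have -> : F = (-2) *: ((@expR R) \o (cst 1 - (2^-1 *: id))).
    by apply/funext => s; rewrite /F [s / 2]mulrC.
  apply: is_derive_eq (is_deriveZ _ (is_derive1_comp _ h)) _.
  rewrite (_ : (cst 1 - 2^-1 *: id) x = 1 - x / 2); last by rewrite [x / 2]mulrC.
  by rewrite /GRing.scale /=; field.
rewrite -set_itvcy (@ge0_continuous_FTC2y _ _ F 0 0).
- by rewrite -EFinB -EFinM ltry.
- by move=> x _; exact: expR_ge0.
- exact: continuous_subspaceT.
- have half_y : x / 2 - 1 @[x --> +oo] --> (+oo : set_system R).
    by apply: cvg_comp (cvg_addrr (- 1)); exact: gt0_cvgMly.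
  rewrite -(mulr0 (- 2)); apply: cvgM; first exact: cvg_cst.
  under eq_fun do rewrite -opprB.
  exact: cvg_comp half_y (@cvgr_expR R).
- by move=> x _; exact: ex_derive.
- apply: cvg_at_right_filter; apply: differentiable_continuous.
  exact/derivable1_diffP/ex_derive.
- move=> x; rewrite in_itv/= andbT => x0.
  by rewrite derive1E derive_val ger0_norm// ltW.
Qed.

Lemma measurable_expR_half_sqr (R : realType) :
  measurable_fun setT (fun s : R => expR (- (s ^+ 2 / 2))).
Proof.
apply: continuous_measurable_fun => s.
apply: continuous_comp; last exact: continuous_expR.
apply: cvgN; apply: cvgM; last exact: cvg_cst.
exact: exprn_continuous.
Qed.

(** The standard normal density has total mass 1; its normalising factor is cleared. *)
Lemma integral_expR_half_sqr (R : realType) :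
  (\int[lebesgue_measure]_s (expR (- (s ^+ 2 / 2)) : R)%:E)%E =
  (Num.sqrt (2 * pi))%:E.
Proof.
have mf := @measurable_expR_half_sqr R.
have := @integral_normal_pdf R 0 1.
rewrite /normal_pdf oner_eq0.
have sq0 : 0 < Num.sqrt (2 * pi : R) by rewrite sqrtr_gt0 mulr_gt0 ?pi_gt0.
under eq_integral => s _.
  rewrite /normal_peak /normal_fun expr1n mul1r -mulr_natl subr0 mulNr EFinM.
  over.
rewrite ge0_integralZl//=; last exact/measurable_EFinP.
move=> /(congr1 (mule (Num.sqrt (2 * pi))%:E)).
by rewrite muleA -EFinM divff ?gt_eqF// mul1e mule1.
Qed.

Lemma continuous_stirling_kernel (R : realType) (y : R) : y != 0 ->
  continuous (stirling_kernel y).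
Proof.
move=> y0 s; apply: cvgM.
  apply: (@continuous_comp _ _ _ (fun s : R => 1 + s / y)
    (fun t : R => Num.max t 0 `^ (y ^+ 2))).
    apply: cvgD; first exact: cvg_cst.
    by apply: cvgM; [exact: cvg_id|exact: cvg_cst].
  by apply: continuous_max0_powR; rewrite exprn_even_gt0.
apply: continuous_comp; last exact: continuous_expR.
by apply: cvgN; apply: cvgM; [exact: cvg_cst|exact: cvg_id].
Qed.

Lemma integrable_stirling_kernel (R : realType) (y : R) : 1 <= y ->
  lebesgue_measure.-integrable setT (EFin \o stirling_kernel y).
Proof.
move=> y1; apply: le_integrable (integrable_expR_abs R) => //.
  apply/measurable_EFinP; apply: continuous_measurable_fun.
  by apply: continuous_stirling_kernel; rewrite gt_eqF// (lt_le_trans ltr01).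
move=> s _ /=; rewrite lee_fin (ger0_norm (expR_ge0 _)) ger0_norm ?stirling_kernel_ge0//.
exact: stirling_kernel_bound.
Qed.

(** * Stirling's formula for the Gamma function *)

(** Substitute [t = y s + y ^ 2]. Factoring [y ^ 2] out of the base and [- y ^ 2] out of the
    exponential leaves the kernel; the remaining factor [y] is the Jacobian. *)
Lemma Gamma_stirling_kernel (R : realType) (y : R) : 1 <= y ->
  Gamma (y ^+ 2 + 1) = y * (y ^+ 2) `^ (y ^+ 2) * expR (- y ^+ 2) *
    \int[lebesgue_measure]_s stirling_kernel y s.
Proof.
move=> y1; have y0 : 0 < y by lra.
have p0 : 0 < y ^+ 2 by rewrite exprn_gt0.
set c := y * _ * _.
have c0 : 0 < c by rewrite !mulr_gt0 ?powR_gt0 ?expR_gt0.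
pose G (t : R) := Num.max t 0 `^ (y ^+ 2) * expR (- t).
have G0 t : 0 <= G t by rewrite mulr_ge0 ?powR_ge0 ?expR_ge0.
have cG : continuous G.
  move=> t; apply: cvgM; first exact: continuous_max0_powR.
  by apply: continuous_comp; [exact: oppr_continuous|exact: continuous_expR].
(* Truncation makes the integrand vanish for [t <= 0], so the integral extends to the whole line,
   where the affine substitution is a bijection. *)
have -> : Gamma (y ^+ 2 + 1) = \int[lebesgue_measure]_t G t.
  rewrite /Gamma Rintegral_mkcond; apply: eq_Rintegral => t _.
  rewrite patchE /G mem_setE in_itv /= andbT; case: ifPn => t0.
    by rewrite addrK max_l// ltW.
  by rewrite max_r ?powR0 ?mul0r ?gt_eqF// leNgt.
pose F (s : R) := y * s + y ^+ 2.
have dF (x : R) : is_derive x (1 : R) F y.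
  have := is_deriveD (is_deriveZ y (is_derive_id x (1 : R)))
    (is_derive_cst (y ^+ 2) x (1 : R)).
  by move=> h; apply: is_derive_eq h _; rewrite /GRing.scale /= mulr1 addr0.
have F'E : F^`()%classic = cst y.
  by apply/funext => x; rewrite derive1E derive_val.
rewrite /Rintegral (@increasing_ge0_integration_by_substitutionT _ F G)//.
- rewrite F'E.
  have GFE s : ((G \o F) * cst y) s = c * stirling_kernel y s.
    rewrite /= /G /F /stirling_kernel.
    change (Num.max (y * s + y ^+ 2) 0 `^ (y ^+ 2) * expR (- (y * s + y ^+ 2)) * y
      = c * (Num.max (1 + s / y) 0 `^ (y ^+ 2) * expR (- (y * s)))).
    have -> : Num.max (y * s + y ^+ 2) 0 = y ^+ 2 * Num.max (1 + s / y) 0.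
      rewrite maxr_pMr ?(ltW p0)// mulr0; congr Num.max.
      by field; rewrite gt_eqF.
    rewrite powRM ?(ltW p0) ?le_max ?lexx ?orbT// opprD expRD /c.
    ring.
  (* [c] is pulled out at the level of extended reals; [fine] respects the product because the
     kernel is integrable. *)
  transitivity (fine (c%:E *
      \int[lebesgue_measure]_s (stirling_kernel y s)%:E)%E); last first.
    by rewrite fineM//; exact: integrable_fin_num (integrable_stirling_kernel y1).
  congr fine; rewrite -ge0_integralZl//=.
  + by apply: eq_integral => s _; rewrite -EFinM; congr EFin; exact: GFE.
  + apply/measurable_EFinP; apply: continuous_measurable_fun.
    by apply: continuous_stirling_kernel; rewrite gt_eqF.
  + by move=> s _; rewrite lee_fin stirling_kernel_ge0.
  + by rewrite lee_fin ltW.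
- by move=> s t st; rewrite ltrD2r ltr_pM2l.
- by rewrite F'E => ?; exact: cvg_cst.
- by rewrite F'E; exact: is_cvg_cst.
- by rewrite F'E; exact: is_cvg_cst.
- apply: cvg_comp (cvg_addrr_Ny _); exact: gt0_cvgMrNy.
- apply: cvg_comp (cvg_addrr _); exact: gt0_cvgMry.
Qed.

(** Dominated convergence applies to sequences, so the limit is tested along every sequence tending
    to infinity. *)
Lemma Rintegral_stirling_kernel_cvg (R : realType) :
  \int[lebesgue_measure]_s stirling_kernel y s @[y --> +oo] --> Num.sqrt (2 * pi : R).
Proof.
apply/cvg_pinftyP => u uy.
(* The domination needs [1 <= y] at every index; [v] ensures this and eventually equals [u]. *)
pose v n := Num.max (u n) 1.
have v1 n : 1 <= v n by rewrite le_max lexx orbT.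
have uv : \forall n \near \oo, u n = v n.
  have /cvgryPge /(_ 1) := uy; apply: filterS => n un.
  by rewrite /v max_l.
have vy : v n @[n --> \oo] --> +oo.
  by apply: cvg_trans uy; apply: near_eq_cvg; exact: uv.
have [||||_ _] := @dominated_convergence _ _ R lebesgue_measure setT measurableT
    (fun n => EFin \o stirling_kernel (v n))
    (EFin \o (fun s : R => expR (- (s ^+ 2 / 2)))) _ _ _ _ (integrable_expR_abs R).
- by move=> n; have /integrableP[mK _] := integrable_stirling_kernel (v1 n).
- by apply/measurable_EFinP; exact: measurable_expR_half_sqr.
- apply/aeW => s _; apply/fine_cvgP; split; first exact: nearW.
  exact: cvg_comp vy (@stirling_kernel_cvg R s).
- apply/aeW => s n _ /=; rewrite lee_fin ger0_norm ?stirling_kernel_ge0//.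
  exact: stirling_kernel_bound.
rewrite integral_expR_half_sqr => /fine_cvg; apply: cvg_trans.
by apply: near_eq_cvg; move: uv; apply: filterS => n /= ->.
Qed.

(** Taking [y = sqrt x] makes the prefactor [sqrt x * x ^ x * e ^ (- x)], so the quotient is the
    kernel integral divided by its limit. *)
Lemma stirling_Gamma (R : realType) :
  Gamma (x + 1) / (Num.sqrt (2 * pi) * x `^ (x + 2^-1) * expR (- x))
    @[x --> +oo] --> (1 : R).
Proof.
have p0 : Num.sqrt (2 * pi : R) != 0 by rewrite gt_eqF// sqrtr_gt0 mulr_gt0 ?pi_gt0.
have sqrt_y : Num.sqrt x @[x --> +oo] --> (+oo : set_system R).
  apply/cvgryPge => A; near=> x.
  have Ax : A ^+ 2 <= x by near: x; apply: nbhs_pinfty_ge; rewrite num_real.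
  by apply: le_trans (ler_norm A) _; rewrite -sqrtr_sqr ler_wsqrtr.
have : (\int[lebesgue_measure]_s stirling_kernel (Num.sqrt x) s)
    / Num.sqrt (2 * pi) @[x --> +oo] --> Num.sqrt (2 * pi) / Num.sqrt (2 * pi : R).
  apply: cvgM; last exact: cvg_cst.
  exact: cvg_comp sqrt_y (@Rintegral_stirling_kernel_cvg R).
rewrite mulfV//; apply: cvg_trans; apply: near_eq_cvg; near=> x.
have x1 : 1 <= x by near: x; apply: nbhs_pinfty_ge; rewrite num_real.
have x0 : 0 < x by lra.
have s1 : 1 <= Num.sqrt x by rewrite -sqrtr1 ler_wsqrtr.
have xs : Num.sqrt x ^+ 2 = x by rewrite sqr_sqrtr// ltW.
rewrite /= -[x in Gamma (x + 1)]xs Gamma_stirling_kernel// xs.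
rewrite powRD ?(gt_eqF x0) ?implybT// powR12_sqrt ?(ltW x0)//.
field; rewrite p0 !gt_eqF ?expR_gt0 ?powR_gt0//.
by rewrite (lt_le_trans ltr01).
Unshelve. all: by end_near. Qed.

(** * Comparison of the general formula with Stirling's *)

Theorem corollary1 (R : realType) (K M N : R * R -> R) (r : R -> R)
  (eps eps' theta theta' sigma sigma' : R)
  (K_mean : is_mean setT K) (K_sym : symmetric_on setT K)
  (K_hom : homogeneous_on setT K) (K_diff2 : twice_differentiable_on setT K)
  (M_pos : forall a b, 0 < a -> 0 < b -> 0 < M (a, b))
  (M_mean : is_mean `]0, +oo[ M) (M_sym : symmetric_on `]0, +oo[ M)
  (M_hom : homogeneous_on `]0, +oo[ M) (M_diff : differentiable_on `]0, +oo[ M)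
  (N_mean : is_mean setT N) (N_sym : symmetric_on setT N)
  (N_hom : homogeneous_on setT N) (N_diff : differentiable_on setT N)
  (r_lim : r x @[x --> +oo] --> (0 : R))
  (eps_sum : eps + eps' = 1) (theta_sum : theta + theta' = 1)
  (sigma_sum : sigma + sigma' = 1) :
  asymp_equiv_on
    [set x : R | - Num.min 1 (Num.min theta theta') < x]
    (fun x => Gamma (x + 1))
    (fun x => Num.sqrt (2 * pi)
       * M (x + theta, x + theta') `^ K (x + eps, x + eps')
       * expR (- N (x + sigma, x + sigma')) * expR (r x)).
Proof.
have KE x : K (x + eps, x + eps') = x + 2^-1.
  rewrite (homogeneous_mean_arith K_mean K_sym K_hom); last exact: K_diff2.1.
  by rewrite addrACA eps_sum; field.
have NE x : N (x + sigma, x + sigma') = x + 2^-1.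
  rewrite (homogeneous_mean_arith N_mean N_sym N_hom); last exact: N_diff.
  by rewrite addrACA sigma_sum; field.
have dM : differentiable M (1 : R, 1 : R).
  by apply: M_diff; split; rewrite /= in_itv/= ltr01.
have xlnM := mean_ln_asymp (a := theta) (b := theta') M_mean M_sym M_hom dM.
rewrite theta_sum in xlnM.
have V0 : x^-1 @[x --> +oo] --> (0 : R).
  by apply/gtr0_cvgV0 => //; exact: nbhs_pinfty_gt.
(* [E] is the logarithm of Stirling's expression divided by the claimed one: with [q = M / x] it is
   [1 / 2 - (x + 1 / 2) ln q - r]. Writing [ln q] as [x^-1 * (x ln q)] lets [xlnM] give both
   limits. *)
pose E x := 2^-1 - (x * ln (M (x + theta, x + theta') / x)
  + 2^-1 * (x^-1 * (x * ln (M (x + theta, x + theta') / x)))) - r x.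
have E0 : E x @[x --> +oo] --> 2^-1 - (1 / 2 + 2^-1 * (0 * (1 / 2))) - (0 : R).
  apply: cvgB => //; apply: cvgB; first exact: cvg_cst.
  by apply: cvgD => //; apply: cvgM; [exact: cvg_cst|exact: cvgM].
have := cvg_comp _ _ E0 (@continuous_expR R _).
rewrite mul0r mulr0 addr0 subr0 div1r subrr expR0 => expE.
have lim1 : Gamma (x + 1) / (Num.sqrt (2 * pi) * x `^ (x + 2^-1) * expR (- x)) *
    expR (E x) @[x --> +oo] --> (1 : R).
  by rewrite -[X in _ --> X]mulr1; apply: cvgM expE; exact: stirling_Gamma.
(* The unrestricted limit at infinity implies the one within the domain. *)
rewrite /asymp_equiv_on; apply: cvg_within_filter.
apply: cvg_trans lim1; apply: near_eq_cvg; near=> x.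
have x0 : 0 < x by near: x; exact: nbhs_pinfty_gt.
have xt : 0 < x + theta.
  by rewrite -ltrBlDr sub0r; near: x; apply: nbhs_pinfty_gt; rewrite num_real.
have xt' : 0 < x + theta'.
  by rewrite -ltrBlDr sub0r; near: x; apply: nbhs_pinfty_gt; rewrite num_real.
have M0 := M_pos _ _ xt xt'.
rewrite KE NE /E mulKf ?gt_eqF//; set q := M _ / x.
have q0 : 0 < q by rewrite divr_gt0.
(* Splitting off [x] isolates Stirling's power [x ^ (x + 1 / 2)]; the power of [q] becomes an
   exponential. *)
have -> : M (x + theta, x + theta') = x * q by rewrite mulrC divfK// gt_eqF.
rewrite powRM ?(ltW x0) ?(ltW q0)// [q `^ _]/powR (gt_eqF q0).
have -> : 2^-1 - (x * ln q + 2^-1 * ln q) - r x =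
    - (x - (x + 2^-1) + (x + 2^-1) * ln q + r x) by ring.
rewrite !expRN !(expRD, expRN).
field; rewrite ?gt_eqF ?expR_gt0 ?powR_gt0 ?sqrtr_gt0 ?mulr_gt0 ?pi_gt0//.
Unshelve. all: by end_near. Qed.
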